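(* Let $X$ be a completely regular space, let $\Delta_X\subseteq X$ be a closed and discrete subset partitioned into pairwise disjoint subsets $\Delta_X(k)$, $k\in\mathbb Z$, and for each $k\in\mathbb Z$ let $I_X(k)$ be a proper ideal on $\Delta_X(k)$. Suppose that for every $k\in\mathbb Z$ and every open $V\subseteq X$, if $\Delta_X(k)\setminus V\in I_X(k)$, then $\Delta_X(k-1)\setminus cl_X(V)\in I_X(k-1)$. Let $\mathbf Y=\mathbf Y_X$ and $\mathbf Y^*=\mathbf Y\cup\{-\infty,+\infty\}$ be the spaces defined in the context. Then $\mathbf Y$ is completely regular; $\mathbf Y^*$ is regular and no continuous real valued function on $\mathbf Y^*$ separates $+\infty$ and $-\infty$ (i.e. $f(+\infty)=f(-\infty)$ for every continuous $f:\mathbf Y^*\to\mathbb R$); and each of the one-point extensions $\mathbf Y\cup\{+\infty\}$ and $\mathbf Y\cup\{-\infty\}$ of $\mathbf Y$ (subspaces of $\mathbf Y^*$) is regular but not completely regular.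
   Context: Regular and completely regular spaces are assumed to be $T_1$. Construction of $\mathbf Y_X$. For $x\in X\setminus\Delta_X$ and $k\in\mathbb Z$ put $\mathbf x_k=(k,x)$; for $x\in\Delta_X(k)$ put $\mathbf x_k=\{(k,x),(k+1,x)\}$ (so for $x\in\Delta_X$ the point $\mathbf x_k$ is defined only for the unique $k$ with $x\in\Delta_X(k)$). Let $\mathbf Y_X$ be the set of all points $\mathbf x_k$ so defined. Its topology is generated by: the sets $\{\mathbf x_k:x\in V\}$, for $k\in\mathbb Z$ and $V\subseteq X\setminus\Delta_X$ open in $X$; and the sets $\{\mathbf x_k:x\in V\cap((X\setminus\Delta_X)\cup\Delta_X(k))\}\cup\{\mathbf x_{k+1}:x\in V\setminus\Delta_X\}$, for $k\in\mathbb Z$ and $V\subseteq X$ open. Thus $\mathbf Y_X$ is obtained from copies of $X$ numbered by integers by gluing the $k$-th and the $(k+1)$-st copies along $\Delta_X(k)$ and deleting from the $k$-th copy all points of $\Delta_X(m)$ with $m\neq k,k-1$. Put $\Delta_{\mathbf Y}(k)=\{\mathbf x_k:x\in\Delta_X(k)\}$ and $\mathbf Y_k=\{\mathbf x_k:x\in X\setminus\Delta_X\}$. Topology of $\mathbf Y^*=\mathbf Y\cup\{-\infty,+\infty\}$, where $\pm\infty$ are distinct new points: open sets of $\mathbf Y$ are open; the sets $\mathcal V^+_m=\{+\infty\}\cup\bigcup\{\mathbf Y_n:n\geqslant m\}\cup\bigcup\{\Delta_{\mathbf Y}(n):n>m\}$, $m\in\mathbb Z$, form a base at $+\infty$; the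 sets $\mathcal V^-_m=\{-\infty\}\cup\bigcup\{\mathbf Y_n:n\leqslant m\}\cup\bigcup\{\Delta_{\mathbf Y}(n):n<m\}$, $m\in\mathbb Z$, form a base at $-\infty$. *)

(* Defs.v *)
From HB Require Import structures.
From mathcomp Require Import all_boot all_order all_algebra.
From mathcomp Require Import finmap.
From mathcomp Require Import all_classical all_reals all_analysis.

Set Implicit Arguments.
Unset Strict Implicit.
Unset Printing Implicit Defensive.

Import Order.TTheory GRing.Theory Num.Theory.

Local Open Scope classical_set_scope.
Local Open Scope ring_scope.

(* The library's separation axioms do not include T1. Its
   completely_regular_space separates points from closed sets by
   uniform_separator, which uniform_separatorP identifies with separation by a
   continuous function into [0, 1]. *)
Definition regular_T1 (T : topologicalType) : Prop :=
  accessible_space T /\ regular_space T.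

Definition completely_regular_T1 (T : topologicalType) : Prop :=
  accessible_space T /\ completely_regular_space T.

Definition discrete_subset (T : topologicalType) (A : set T) : Prop :=
  A `<=` isolated A.

Definition proper_set_ideal (T : Type) (S : set T) (J : set_system T) : Prop :=
  [/\ forall A, J A -> A `<=` S,
      J set0,
      forall A B, B `<=` A -> J A -> J B,
      forall A B, J A -> J B -> J (A `|` B)
    & ~ J S].

Section Gluing.
Context (X : topologicalType) (D : int -> set X).

Definition DeltaX : set X := \bigcup_k D k.

(* The point x_k is represented by its label (k, x): since the D k are pairwise
   disjoint, distinct labels name distinct points, and a point x of D k has the
   single label (k, x), which stands for the class {(k, x), (k + 1, x)}. *)
Definition gluing : Type :=
  {p : int * X | (~` DeltaX `|` D p.1) p.2}.

HB.instance Definition _ := gen_eqMixin gluing.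
HB.instance Definition _ := gen_choiceMixin gluing.

(* {x_k : x in A}, restricted to those x in A for which x_k is defined. *)
Definition level (k : int) (A : set X) : set gluing :=
  [set y | (sval y).1 = k /\ A (sval y).2].

Definition gluing_subbase : set_system gluing :=
  [set U | exists k V, [/\ open V, V `<=` ~` DeltaX & U = level k V]] `|`
  [set U | exists k V, open V /\
    U = level k (V `&` (~` DeltaX `|` D k)) `|` level (k + 1) (V `\` DeltaX)].

HB.instance Definition _ :=
  isSubBaseTopological.Build gluing gluing_subbase id.

Definition DeltaY (k : int) : set gluing := level k (D k).

Definition Ylevel (k : int) : set gluing := level k (~` DeltaX).

Inductive gluing_ext : Type := Yin of gluing | Yminfty | Ypinfty.

HB.instance Definition _ := gen_eqMixin gluing_ext.
HB.instance Definition _ := gen_choiceMixin gluing_ext.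

Definition pinfty_tail (m : int) : set gluing :=
  \bigcup_(n in [set n | m <= n]) Ylevel n `|`
  \bigcup_(n in [set n | m < n]) DeltaY n.

Definition minfty_tail (m : int) : set gluing :=
  \bigcup_(n in [set n | n <= m]) Ylevel n `|`
  \bigcup_(n in [set n | n < m]) DeltaY n.

Definition Vplus (m : int) : set gluing_ext :=
  [set Ypinfty] `|` Yin @` pinfty_tail m.

Definition Vminus (m : int) : set gluing_ext :=
  [set Yminfty] `|` Yin @` minfty_tail m.

(* The topology determined by the open sets of Y together with the local bases
   Vplus and Vminus; see open_Yin, nbhs_Ypinfty and nbhs_Yminfty below. *)
Definition gluing_ext_open : set_system gluing_ext :=
  [set U | [/\ open (Yin @^-1` U),
               U Ypinfty -> exists m, Vplus m `<=` U
             & U Yminfty -> exists m, Vminus m `<=` U]].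

Definition Yplus : set gluing_ext := range Yin `|` [set Ypinfty].

Definition Yminus : set gluing_ext := range Yin `|` [set Yminfty].

Lemma pinfty_tailS m n : m <= n -> pinfty_tail n `<=` pinfty_tail m.
Proof.
move=> mn y [] [k /= nk yk]; [left|right]; exists k => //=.
  exact: le_trans nk.
exact: le_lt_trans nk.
Qed.

Lemma minfty_tailS m n : m <= n -> minfty_tail m `<=` minfty_tail n.
Proof.
move=> mn y [] [k /= nk yk]; [left|right]; exists k => //=.
  exact: le_trans mn.
exact: lt_le_trans mn.
Qed.

Lemma VplusS m n : m <= n -> Vplus n `<=` Vplus m.
Proof. by move=> mn; apply/setUS/image_subset/pinfty_tailS. Qed.

Lemma VminusS m n : m <= n -> Vminus m `<=` Vminus n.
Proof. by move=> mn; apply/setUS/image_subset/minfty_tailS. Qed.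

Lemma gluing_ext_openT : gluing_ext_open setT.
Proof. by split; [exact: openT|exists 0|exists 0]. Qed.

Lemma gluing_ext_openI : setI_closed gluing_ext_open.
Proof.
move=> U V [oU pU mU] [oV pV mV]; split.
- exact: openI.
- move=> [/pU[m mU'] /pV[n nV]]; exists (Num.max m n) => y yV.
  split; [apply: mU'|apply: nV]; apply: VplusS yV; rewrite le_max lexx//.
  by rewrite orbT.
- move=> [/mU[m mU'] /mV[n nV]]; exists (Num.min m n) => y yV.
  split; [apply: mU'|apply: nV]; apply: VminusS yV; rewrite ge_min lexx//.
  by rewrite orbT.
Qed.

Lemma gluing_ext_open_bigU (I : Type) (f : I -> set gluing_ext) :
  (forall i, gluing_ext_open (f i)) -> gluing_ext_open (\bigcup_i f i).
Proof.
move=> of_; split.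
- by rewrite preimage_bigcup; apply: bigcup_open => i _; have [] := of_ i.
- move=> [i _ fi]; have [_ /(_ fi)[m mf] _] := of_ i.
  by exists m => y /mf ?; exists i.
- move=> [i _ fi]; have [_ _ /(_ fi)[m mf]] := of_ i.
  by exists m => y /mf ?; exists i.
Qed.

HB.instance Definition _ := isOpenTopological.Build gluing_ext
  gluing_ext_openT gluing_ext_openI gluing_ext_open_bigU.

Lemma open_gluing_subbase U : gluing_subbase U -> open U.
Proof.
move=> sU; exists [set U]; last by rewrite bigcup_set1.
move=> _ ->; exists (fset1 U); last by rewrite set_fset1 bigcap_set1.
by move=> V /fset1P ->; rewrite inE.
Qed.

Lemma open_Yin (U : set gluing) : open (Yin @` U) <-> open U.
Proof.
have YinU : Yin @^-1` (Yin @` U) = U.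
  by apply/seteqP; split => [y [z Uz [<-]]|y Uy] //; exists y.
split; first by case; rewrite YinU.
by move=> oU; split; [rewrite YinU|case|case].
Qed.

Lemma open_Ylevel k : closed DeltaX -> open (Ylevel k).
Proof.
move=> clD.
apply: open_gluing_subbase; left; exists k, (~` DeltaX); split => //.
exact: closed_openC.
Qed.

Lemma open_star k : open (Ylevel k `|` DeltaY k `|` Ylevel (k + 1)).
Proof.
apply: open_gluing_subbase; right; exists k, setT; split; first exact: openT.
rewrite setTI setTD; congr (_ `|` _).
by apply/seteqP; split => y; rewrite /Ylevel /DeltaY /level /=; tauto.
Qed.

Lemma open_pinfty_tail m : closed DeltaX -> open (pinfty_tail m).
Proof.
move=> clD.
suff -> : pinfty_tail m = Ylevel m `|`
    \bigcup_(n in [set n | m < n]) (Ylevel n `|` DeltaY n `|` Ylevel (n + 1)).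
  apply: openU; first exact: open_Ylevel.
  by apply: bigcup_open => n _; exact: open_star.
apply/seteqP; split => y.
- move=> [] [n /= mn yn]; last by right; exists n => //; left; right.
  move: mn; rewrite le_eqVlt => /predU1P[->|mn]; first by left.
  by right; exists n => //; left; left.
- move=> [ym|[n /= mn [[yn|yn]|yn]]].
  + by left; exists m => //=.
  + by left; exists n => //=; exact: ltW.
  + by right; exists n.
  + by left; exists (n + 1) => //=; rewrite (le_trans (ltW mn))// lerDl.
Qed.

Lemma open_minfty_tail m : closed DeltaX -> open (minfty_tail m).
Proof.
move=> clD.
suff -> : minfty_tail m = Ylevel m `|`
    \bigcup_(n in [set n | n < m]) (Ylevel n `|` DeltaY n `|` Ylevel (n + 1)).
  apply: openU; first exact: open_Ylevel.
  by apply: bigcup_open => n _; exact: open_star.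
apply/seteqP; split => y.
- move=> [] [n /= mn yn]; last by right; exists n => //; left; right.
  move: mn; rewrite le_eqVlt => /predU1P[<-|mn]; first by left.
  by right; exists n => //; left; left.
- move=> [ym|[n /= mn [[yn|yn]|yn]]].
  + by left; exists m => //=.
  + by left; exists n => //=; exact: ltW.
  + by right; exists n.
  + by left; exists (n + 1) => //=; rewrite lezD1.
Qed.

Lemma open_Vplus m : closed DeltaX -> open (Vplus m).
Proof.
move=> clD.
split; last by move=> [//|[]].
- suff -> : Yin @^-1` Vplus m = pinfty_tail m by exact: open_pinfty_tail.
  apply/seteqP; split => [y [//|[z mz [<-]]]|y my] //.
  by right; exists y.
- by move=> _; exists m.
Qed.

Lemma open_Vminus m : closed DeltaX -> open (Vminus m).
Proof.
move=> clD.
split; first 1 last.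
- by move=> [//|[]].
- by move=> _; exists m.
- suff -> : Yin @^-1` Vminus m = minfty_tail m by exact: open_minfty_tail.
  apply/seteqP; split => [y [//|[z mz [<-]]]|y my] //.
  by right; exists y.
Qed.

Lemma nbhs_Ypinfty : closed DeltaX ->
  nbhs Ypinfty = filter_from [set: int] Vplus.
Proof.
move=> clD.
apply/seteqP; split => U.
  rewrite nbhsE => -[V [[_ pV _] /pV[m mV]] VU].
  by exists m => //; exact: subset_trans VU.
move=> [m _ mU]; rewrite nbhsE; exists (Vplus m) => //.
by split; [exact: open_Vplus|left].
Qed.

Lemma nbhs_Yminfty : closed DeltaX ->
  nbhs Yminfty = filter_from [set: int] Vminus.
Proof.
move=> clD.
apply/seteqP; split => U.
  rewrite nbhsE => -[V [[_ _ pV] /pV[m mV]] VU].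
  by exists m => //; exact: subset_trans VU.
move=> [m _ mU]; rewrite nbhsE; exists (Vminus m) => //.
by split; [exact: open_Vminus|left].
Qed.

End Gluing.

Arguments Yin {X D}.
Arguments Ypinfty {X D}.
Arguments Yminfty {X D}.
Arguments Yplus {X} D _.
Arguments Yminus {X} D _.

(* Main.v *)
Require Import Defs.
From mathcomp Require Import all_boot all_order all_algebra.
From mathcomp Require Import all_classical all_reals all_analysis.
From mathcomp Require Import zify lra.
Import numFieldNormedType.Exports.
Import Order.TTheory GRing.Theory Num.Theory.

Local Open Scope classical_set_scope.
Local Open Scope ring_scope.

(** Call the copy of [X] with number [k] its [k]-th sheet. A point [x_k] has a
    neighbourhood basis made of stars: neighbourhoods of [x] spread over the one
    or two sheets through [x_k] ([nbhs_gluingE]). Hence a family of continuous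
    functions, one per sheet, that agree where sheets are glued is continuous on
    [Y] ([paste_continuous]). A function on [X] that is 0 at [x] and 1 off a small
    neighbourhood can thus be copied to the sheets through [x_k] and replaced by 1
    on the others; being 1 near both ends, it extends to [Y*]. So points of [Y]
    are separated by functions from closed sets, even in [Y*] ([Yin_separated]).
    Regularity at the two ends is seen on the basic sets directly.

    The negative statements rest on [bound_propagates]. Let [g] be continuous on
    [Y], and suppose that [g < c] on the [k]-th glued set outside a set of the
    ideal [J k]. The points [x] whose copy on the [k]-th sheet satisfies [g < c]
    form an open set [V] of [X], so almost all points of [D (k - 1)] are in the
    closure of [V]. As these lie on the [k]-th sheet too, [g <= c] there. Thus a
    bound on one glued set descends to all lower ones, at an arbitrarily small
    cost, up to sets of a proper ideal. A function on [Y*] close to its value at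
    [+oo] on a high glued set therefore takes such values arbitrarily near [-oo],
    whence [f Yminfty <= f Ypinfty], and equality by applying this to [- f]. The
    same descent contradicts complete regularity at [+oo], and, applied to
    [1 - g], complete regularity at [-oo]. *)

(** * Separation in arbitrary spaces *)

Lemma accessible_open_setC1 (T : topologicalType) :
  accessible_space T <-> forall x : T, open (~` [set x]).
Proof.
split=> [aT x|oT x y xy].
  exact/closed_openC/accessible_closed_set1.
exists (~` [set y]); split; first exact: oT.
  by rewrite inE /=; exact/eqP.
by rewrite setCK inE.
Qed.

Lemma uniform_separator_open (R : realType) (T : topologicalType)
    (A B : set T) :
  uniform_separator A B ->
  exists U V : set T, [/\ open U, open V, A `<=` U, B `<=` V & U `&` V = set0].
Proof.
move=> /(@uniform_separatorP _ R)[f [/continuousP cf _ fA fB]].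
exists (f @^-1` [set r | r < 2^-1]), (f @^-1` [set r | 2^-1 < r]); split.
- exact/cf/open_lt.
- exact/cf/open_gt.
- move=> x Ax /=; have -> : f x = 0 by apply: fA; exists x.
  by rewrite invr_gt0.
- move=> x Bx /=; have -> : f x = 1 by apply: fB; exists x.
  by rewrite invf_lt1// ltr1n.
- apply/disjoints_subset => x /= fx; apply/negP; rewrite -leNgt; exact: ltW.
Qed.

Lemma set_type_regular_T1 (T : topologicalType) (S : set T) :
  regular_T1 T -> regular_T1 (set_type S).
Proof.
have cval : continuous (set_val : S -> T) by exact: initial_continuous.
move=> [/accessible_open_setC1 aT rT]; split.
  apply/accessible_open_setC1 => x.
  rewrite (_ : ~` [set x] = set_val @^-1` ~` [set set_val x]).
    by move/continuousP : cval; apply; exact: aT.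
  apply/seteqP; split => y /= xy; apply: contra_not xy; last by move=> ->.
  by rewrite !set_valE => /val_inj.
move=> x; apply/regular_openP => A cA Ax.
have [C oC CA] : open (~` A) by exact: closed_openC.
have Cx : C (set_val x).
  suff : (set_val @^-1` C) x by [].
  by rewrite CA.
have := rT (set_val x); move=> /regular_openP /(_ (~` C))[].
- exact: open_closedC.
- by move=> /(_ Cx).
move=> U [V [oU oV Ux CV UV]].
exists (set_val @^-1` U), (set_val @^-1` V); split => //.
- by move/continuousP : cval; apply.
- by move/continuousP : cval; apply.
- move=> y Ay; apply: CV => Cy.
  suff : (~` A) y by [].
  by rewrite -CA.
- by rewrite -preimage_setI UV preimage_set0.
Qed.

(** Complete regularity of a subspace at a point, pulled back along a map into
    it: this is how the two one-point extensions are refuted. *)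
Lemma completely_regular_pullback (R : realType) (T Z : topologicalType)
    (S U : set T) (s : T) (i : Z -> T) :
  completely_regular_space (set_type S) -> S s -> open U -> U s ->
  continuous i -> (forall z, S (i z)) ->
  exists g : Z -> R, [/\ continuous g, forall z, ~ U (i z) -> g z = 1 &
    exists W, [/\ open W, W s & forall z, W (i z) -> g z < 2^-1]].
Proof.
move=> crS Ss oU Us ci iS.
have cval : continuous (set_val : S -> T) by exact: initial_continuous.
pose j (z : Z) : S := SigSub (mem_set (iS z)).
have cj : continuous j by apply: continuous_comp_initial => z; exact: ci.
pose s' : S := SigSub (mem_set Ss).
have : uniform_separator [set s'] (set_val @^-1` (~` U)).
  apply: crS; last exact.
  rewrite preimage_setC; apply: open_closedC.
  by move/continuousP : cval; exact.
move=> /(@uniform_separatorP _ R)[f [cf _ f0 f1]].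
exists (f \o j); split.
- by move=> z; apply: continuous_comp; [exact: cj|exact: cf].
- by move=> z Uz; apply: f1; exists (j z).
have [W oW WE] : open (f @^-1` [set r | r < 2^-1]).
  by move/continuousP : cf; apply; exact: open_lt.
exists W; split => //.
  suff : (set_val @^-1` W) s' by [].
  rewrite WE /=; have -> : f s' = 0 by apply: f0; exists s'.
  by rewrite invr_gt0.
move=> z Wz; suff : (f @^-1` [set r | r < 2^-1]) (j z) by [].
by rewrite -WE.
Qed.

Section Gluing.
Context (R : realType) (X : topologicalType) (D : int -> set X).
Context (X_cr : completely_regular_T1 X).
Context (D_closed : closed (DeltaX D)).
Context (D_discrete : discrete_subset (DeltaX D)).
Context (D_disjoint : trivIset [set: int] D).

Local Notation Y := (gluing D).
Local Notation Ystar := (gluing_ext D).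
Implicit Types (p q : Y) (k m n : int) (x : X) (V : set X).

(** * The topology of the gluing *)

Lemma D_inj {k n x} : D k x -> D n x -> k = n.
Proof. by move=> kx nx; apply: (D_disjoint k n) => //; exists x. Qed.

Lemma D_sub_DeltaX {k x} : D k x -> DeltaX D x.
Proof. by exists k. Qed.

Lemma gluing_inj p q :
  (sval p).1 = (sval q).1 -> (sval p).2 = (sval q).2 -> p = q.
Proof.
move: p q => [[k x] kx] [[n y] ny] /= kn xy; subst n y.
by congr exist; exact: Prop_irrelevance.
Qed.

Lemma gluing_D {p} : DeltaX D (sval p).2 -> D (sval p).1 (sval p).2.
Proof. by case: (svalP p). Qed.

(** The basic neighbourhood of [x_k] traced by a neighbourhood [V] of [x]: one
    sheet, or, when [x] is a point along which two sheets are glued, both. *)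
Definition star p V : set Y :=
  [set q | V (sval q).2 /\ ((sval q).1 = (sval p).1 \/
     D (sval p).1 (sval p).2 /\ (sval q).1 = (sval p).1 + 1)].

(** The filter generated by the stars of [p]; [nbhs_gluingE] identifies it with
    the neighbourhood filter. *)
Definition star_nbhs p : set_system Y :=
  [set U | exists V, [/\ open V, V (sval p).2 & star p V `<=` U]].

Lemma isolating_nbhs x : exists V,
  [/\ open V, V x & V `&` DeltaX D `<=` [set x]].
Proof.
have [Dx|nDx] := pselect (DeltaX D x); last first.
  exists (~` DeltaX D); split; [exact: closed_openC|exact|by move=> y []].
have [_ [W]] := D_discrete _ Dx; rewrite nbhsE => -[V [oV Vx] VW] WE.
by exists V; split=> // y [Vy Dy]; rewrite -WE; split => //; exact: VW.
Qed.

(** With [star_nbhs_filter] this makes every open set contain a star around each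
    of its points: a subbasic set does, once [V] is shrunk to meet the glued set
    in at most one point. *)
Lemma subbase_star p (U : set Y) : gluing_subbase U -> U p -> star_nbhs p U.
Proof.
move=> [[k [V [oV VD ->]]] [pk Vp]|[k [V [oV ->]]] [[pk [Vp Dp]]|[pk [Vp Dp]]]].
- exists V; split => // q [Vq [qp|[Dp _]]]; first by split; rewrite ?qp.
  by case: (VD _ Vp); exact: D_sub_DeltaX Dp.
- have [V' [oV' V'p V'D]] := isolating_nbhs (sval p).2.
  exists (V `&` V'); split => //; first exact: openI.
  move=> q [[Vq V'q] [qp|[Dp' qp]]].
    left; split; first by rewrite qp.
    by split => //; case: (svalP q); [left|right; rewrite -pk -qp].
  right; split; first by rewrite qp pk.
  split => // Dq.
  (* Otherwise [q] and [p] are one glued point of [X] with two labels. *)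
  have qpE : (sval q).2 = (sval p).2 by exact: V'D.
  move/gluing_D : Dq; rewrite qpE => /(D_inj Dp'); rewrite qp; lia.
- exists (V `&` ~` DeltaX D); split => //.
    by apply: openI => //; exact: closed_openC.
  move=> q [[Vq Dq] [qp|[Dp' _]]]; first by right; split; rewrite ?qp.
  by case: Dp; exact: D_sub_DeltaX Dp'.
Qed.

#[local] Instance star_nbhs_filter p : Filter (star_nbhs p).
Proof.
split.
- by exists setT; split => //; exact: openT.
- move=> A B [V [oV Vp VA]] [W [oW Wp WB]].
  exists (V `&` W); split => //; first exact: openI.
  move=> q [[Vq Wq] pq]; split; first exact: VA.
  exact: WB.
- by move=> A B AB [V [oV Vp VA]]; exists V; split => // q /VA /AB.
Qed.

Lemma nbhs_star p V : open V -> V (sval p).2 -> nbhs p (star p V).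
Proof.
move=> oV Vp; have [Dp|nDp] := pselect (DeltaX D (sval p).2).
  apply: (@filterS _ _ _ (level (sval p).1
      (V `&` (~` DeltaX D `|` D (sval p).1)) `|`
      level ((sval p).1 + 1) (V `\` DeltaX D))).
    move=> q [[qp [Vq _]]|[qp [Vq _]]]; first by split; [|left].
    by split; [|right; split => //; exact: gluing_D].
  apply: open_nbhs_nbhs; split; last first.
    by left; split => //; split => //; exact: svalP p.
  by apply: open_gluing_subbase; right; exists (sval p).1, V.
apply: (@filterS _ _ _ (level (sval p).1 (V `&` ~` DeltaX D))).
  by move=> q [qp [Vq _]]; split; [|left].
apply: open_nbhs_nbhs; split; last by split.
apply: open_gluing_subbase; left; exists (sval p).1, (V `&` ~` DeltaX D).
by split => //; apply: openI => //; exact: closed_openC.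
Qed.

Lemma nbhs_gluingE p : nbhs p = star_nbhs p.
Proof.
apply/seteqP; split => U; last first.
  by move=> [V [oV Vp VU]]; apply: filterS VU _; exact: nbhs_star.
rewrite nbhsE => -[_ [[F Fsub <-] [G FG Gp]] GU].
have [A AF AE] := Fsub _ FG.
apply: filterS GU _; apply: (@filterS _ _ _ G); first by move=> q Gq; exists G.
rewrite -AE in Gp *.
apply: filter_bigI => B BA; apply: subbase_star; last exact: Gp.
by have := AF _ BA; rewrite inE.
Qed.

(** A continuous map on the gluing is a family of continuous maps on the sheets
    which agree where consecutive sheets are glued. *)
Lemma paste_continuous (T : topologicalType) (h : int -> X -> T) :
  (forall k, continuous (h k)) -> (forall k x, D k x -> h k x = h (k + 1) x) ->
  continuous (fun p : Y => h (sval p).1 (sval p).2).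
Proof.
move=> hc hD p A; rewrite /= nbhsE => -[U [oU Up] UA].
change (nbhs p ((fun p : Y => h (sval p).1 (sval p).2) @^-1` A)).
pose V k := h k @^-1` U.
have oV k : open (V k) by have /continuousP := hc k; apply.
rewrite nbhs_gluingE; have [Dp|nDp] := pselect (D (sval p).1 (sval p).2).
  exists (V (sval p).1 `&` V ((sval p).1 + 1)); split.
  - exact: openI.
  - by split => //; rewrite /V /= -hD.
  - by move=> q [[Vq V'q] [qp|[_ qp]]]; apply: UA; rewrite /= qp.
exists (V (sval p).1); split => // q [Vq [qp|[]//]].
by apply: UA; rewrite /= qp.
Qed.

Lemma open_gluing_setC1 p : open (~` [set p]).
Proof.
have [+ _] := X_cr => /accessible_open_setC1 aX.
have cpr : continuous (fun q : Y => (sval q).2).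
  by apply: (paste_continuous _ (fun=> id)) => // k x; exact: cvg_id.
rewrite (_ : ~` [set p] = (fun q : Y => (sval q).2) @^-1` (~` [set (sval p).2])
    `|` \bigcup_(n in [set n | n != (sval p).1]) @Ylevel X D n).
  apply: openU; first by move/continuousP : cpr; exact.
  by apply: bigcup_open => n _; exact: open_Ylevel.
apply/seteqP; split => q /=; last first.
  move=> [qp qpE|[n /eqP np [qn _]] qpE]; first by apply: qp; rewrite qpE.
  by apply: np; rewrite -qn qpE.
move=> qp; have [qp2|] := pselect ((sval q).2 = (sval p).2); last by left.
right; exists (sval q).1 => /=.
  by apply/eqP => qp1; exact/qp/gluing_inj.
split=> // Dq; have Dp := Dq; rewrite qp2 in Dp.
apply/qp/gluing_inj => //.
by apply: (@D_inj _ _ (sval p).2); [rewrite -qp2|]; exact: gluing_D.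
Qed.

(** * The two ends *)

Lemma pinfty_tailE m p : pinfty_tail m p <->
  m < (sval p).1 \/ m = (sval p).1 /\ ~ DeltaX D (sval p).2.
Proof.
split.
  move=> [[n /= + [-> nD]]|[n /= + [-> _]]]; last by left.
  by rewrite le_eqVlt => /predU1P[]; [right|left].
have [Dp|nDp] := pselect (DeltaX D (sval p).2); last first.
  by move=> H; left; exists (sval p).1 => //=; case: H => [/ltW|[->]].
move=> [mp|[//]]; right; exists (sval p).1 => //.
by split => //; exact: gluing_D.
Qed.

Lemma minfty_tailE m p : minfty_tail m p <->
  (sval p).1 < m \/ (sval p).1 = m /\ ~ DeltaX D (sval p).2.
Proof.
split.
  move=> [[n /= + [-> nD]]|[n /= + [-> _]]]; last by left.
  by rewrite le_eqVlt => /predU1P[]; [right|left].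
have [Dp|nDp] := pselect (DeltaX D (sval p).2); last first.
  by move=> H; left; exists (sval p).1 => //=; case: H => [/ltW|[->]].
move=> [mp|[//]]; right; exists (sval p).1 => //.
by split => //; exact: gluing_D.
Qed.

Lemma Vplus_Yin m p : Vplus m (Yin p) <-> pinfty_tail m p.
Proof. by split=> [[//|[q mq [<-]]]|mp] //; right; exists p. Qed.

Lemma Vminus_Yin m p : Vminus m (Yin p) <-> minfty_tail m p.
Proof. by split=> [[//|[q mq [<-]]]|mp] //; right; exists p. Qed.

Lemma Yin_continuous : continuous (@Yin X D).
Proof. by apply/continuousP => A []. Qed.

Lemma extension_continuous (T : topologicalType) (g : Y -> T) (c : T) m n :
  continuous g ->
  (forall p, minfty_tail m p \/ pinfty_tail n p -> g p = c) ->
  continuous (fun y : Ystar => if y is Yin p then g p else c).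
Proof.
move=> /continuousP cg gc; apply/continuousP => A oA; split.
- exact: cg.
- move=> Ac; exists n => -[p /Vplus_Yin np|//|//].
  by rewrite /= gc//; right.
- move=> Ac; exists m => -[p /Vminus_Yin mp|//|//].
  by rewrite /= gc//; left.
Qed.

(** * Points of the gluing *)

(** A function on [X] separating [x] from the complement of a neighbourhood that
    meets the glued set at most in [x] is transported to the one or two sheets
    containing [x_k] and continued by the constant 1: it is 1 wherever a sheet
    carrying it is glued to one that does not, and near the two ends. *)
Lemma Yin_separated p (B : set Ystar) : closed B -> ~ B (Yin p) ->
  uniform_separator [set Yin p] B.
Proof.
move=> cB nBp; set k := (sval p).1; set x := (sval p).2.
have : nbhs p (Yin @^-1` (~` B)).
  apply: open_nbhs_nbhs; split => //.
  by have /continuousP := Yin_continuous; apply; exact: closed_openC.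
rewrite nbhs_gluingE => -[W [oW Wp WB]].
have [W' [oW' W'p W'D]] := isolating_nbhs x.
have : uniform_separator [set x] (~` (W `&` W')).
  by apply: X_cr.2; [exact/open_closedC/openI|apply].
move=> /(@uniform_separatorP _ R)[f [cf f01 f0 f1]].
have {}f0 : f x = 0 by apply: f0; exists x.
have {}f1 y : ~ (W `&` W') y -> f y = 1 by move=> Wy; apply: f1; exists y.
(* The sheets through [p]. *)
pose on n := n = k \/ D k x /\ n = k + 1.
pose h n y := if pselect (on n) is left _ then f y else 1.
have h1 n y : ~ (W `&` W') y -> h n y = 1.
  by rewrite /h => Wy; case: pselect => // _; exact: f1.
have hc n : continuous (h n).
  by rewrite /h; case: pselect => // _ y; exact: cst_continuous.
have hD n y : D n y -> h n y = h (n + 1) y.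
  move=> Dny; have [[Wy W'y]|Wy] := pselect ((W `&` W') y); last by rewrite !h1.
  have yx : y = x by apply: W'D; split => //; exact: D_sub_DeltaX Dny.
  have Dkx : D k x by apply: gluing_D; exists n => //; rewrite -/x -yx.
  have nk : n = k by apply: (@D_inj _ _ x) => //; rewrite -yx.
  by rewrite /h; do 2 case: pselect => //; rewrite nk /on; tauto.
have gc := paste_continuous _ _ hc hD.
pose F (y : Ystar) := if y is Yin q then h (sval q).1 (sval q).2 else 1 : R.
have Fc : continuous F.
  apply: (extension_continuous _ _ _ (k - 1) (k + 2) gc) => q H.
  rewrite /h; case: pselect => // onq; exfalso.
  by case: H => [/minfty_tailE|/pinfty_tailE]; move: onq; rewrite /on; lia.
apply/(@uniform_separatorP _ R); exists F; split => //.
- move=> _ [[q| |] _ <-] /=; rewrite ?in_itv/= ?ler01 ?lexx//.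
  rewrite /h; case: pselect => _; last by rewrite ler01 lexx.
  by have := f01 _ (imageT f (sval q).2); rewrite /= in_itv.
- move=> _ [_ -> <-] /=; rewrite /h; case: pselect => // -[]; by left.
- move=> _ [[q| |] Bq <-] //=.
  have [onq|nq] := pselect (on (sval q).1); last by rewrite /h; case: pselect.
  by apply: h1 => -[Wq _]; apply: (WB q _ Bq); split.
Qed.

Lemma gluing_completely_regular : completely_regular_T1 Y.
Proof.
split; first exact/accessible_open_setC1/open_gluing_setC1.
move=> p B cB nBp.
pose B' : set Ystar := ~` (Yin @` (~` B)).
have : uniform_separator [set Yin p] B'.
  apply: Yin_separated; last by move=> H; apply: H; exists p.
  by apply/open_closedC/open_Yin; exact: closed_openC.
move=> /(@uniform_separatorP _ R)[f [cf f01 f0 f1]].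
apply/(@uniform_separatorP _ R); exists (f \o Yin); split.
- move=> q; apply: continuous_comp; [exact: Yin_continuous|exact: cf].
- by move=> _ [q _ <-]; apply: f01; exists (Yin q).
- by move=> _ [_ -> <-]; apply: f0; exists (Yin p).
- move=> _ [q Bq <-]; apply: f1; exists (Yin q) => //.
  by move=> [r nBr [rq]]; apply: nBr; rewrite rq.
Qed.

(** At the ends, [Vplus (m + 2)] and [Vminus (m + 1)] are disjoint, while the
    latter contains everything but [+oo] that lies outside [Vplus m]: a margin of
    one glued set on each side is enough. *)
Lemma gluing_ext_regular : regular_T1 Ystar.
Proof.
split.
  apply/accessible_open_setC1 => -[p| |]; split => //=.
  - rewrite (_ : _ @^-1` _ = ~` [set p]); first exact: open_gluing_setC1.
    by apply/seteqP; split => q /=; apply: contra_not; [move=> ->|move=> []].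
  - move=> _; exists ((sval p).1 + 1) => _ /[swap] -> /Vplus_Yin/pinfty_tailE.
    lia.
  - move=> _; exists ((sval p).1 - 1) => _ /[swap] -> /Vminus_Yin/minfty_tailE.
    lia.
  - rewrite (_ : _ @^-1` _ = setT); first exact: openT.
    by apply/seteqP; split.
  - by move=> _; exists 0 => _ /[swap] -> [//|[]].
  - rewrite (_ : _ @^-1` _ = setT); first exact: openT.
    by apply/seteqP; split.
  - by move=> _; exists 0 => _ /[swap] -> [//|[]].
move=> [p| |]; apply/regular_openP => A cA nA.
- have [U [V [oU oV pU AV UV]]] :=
    uniform_separator_open R _ _ _ (Yin_separated p A cA nA).
  by exists U, V; split => //; exact: pU.
- have [_ _ /(_ nA)[m mA]] := closed_openC cA.
  exists (Vminus (m - 2)), (Vplus (m - 1)); split.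
  + exact: open_Vminus.
  + exact: open_Vplus.
  + by left.
  + move=> [p| |] Ap; [|by exfalso; apply: nA|by left].
    apply/Vplus_Yin/pinfty_tailE.
    have : ~ minfty_tail m p by move/Vminus_Yin/mA.
    by rewrite minfty_tailE; lia.
  + apply/disjoints_subset => -[p /Vminus_Yin/minfty_tailE pm|_|].
    * move/Vplus_Yin/pinfty_tailE; lia.
    * by move=> [//|[]].
    * by move=> [//|[]].
- have [_ /(_ nA)[m mA] _] := closed_openC cA.
  exists (Vplus (m + 2)), (Vminus (m + 1)); split.
  + exact: open_Vplus.
  + exact: open_Vminus.
  + by left.
  + move=> [p| |] Ap; [|by left|by exfalso; apply: nA].
    apply/Vminus_Yin/minfty_tailE.
    have : ~ pinfty_tail m p by move/Vplus_Yin/mA.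
    by rewrite pinfty_tailE; lia.
  + apply/disjoints_subset => -[p /Vplus_Yin/pinfty_tailE pm| |_].
    * move/Vminus_Yin/minfty_tailE; lia.
    * by move=> [//|[]].
    * by move=> [//|[]].
Qed.

(** * Propagation of upper bounds down the sheets *)

Context (J : int -> set_system X).
Context (J_ideal : forall k : int, proper_set_ideal (D k) (J k)).
Context (J_step : forall (k : int) (V : set X), open V ->
  J k (D k `\` V) -> J (k - 1) (D (k - 1) `\` closure V)).

Definition superlevel (g : Y -> R) (k : int) (c : R) : set X :=
  [set x | D k x /\ exists p, sval p = (k, x) /\ c <= g p].

(** A point of [D (k - 1)] lies on the [k]-th sheet, so it is a limit of points of
    that sheet with [g < c] as soon as it is in the closure of [V] below. *)
Lemma superlevel_step (g : Y -> R) k c c' : continuous g -> c < c' ->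
  J k (superlevel g k c) -> J (k - 1) (superlevel g (k - 1) c').
Proof.
move=> /continuousP cg cc' Jk.
pose V := [set x | exists p, sval p = (k, x) /\ g p < c].
(* Near a glued point [x], every point of [X] has a copy on the [k]-th sheet,
   since discreteness keeps the other glued points away. *)
have oV : open V.
  rewrite openE => x [p [px gp]]; rewrite /interior nbhsE.
  have : nbhs p (g @^-1` [set r | r < c]).
    by apply: open_nbhs_nbhs; split => //; apply: cg; exact: open_lt.
  rewrite nbhs_gluingE => -[W [oW]]; rewrite px /= => Wx Wg.
  have [W' [oW' W'x W'D]] := isolating_nbhs x.
  exists (W `&` W'); first by split; [exact: openI|].
  move=> y [Wy W'y].
  have ky : (~` DeltaX D `|` D k) y.
    have [Dy|] := pselect (DeltaX D y); last by left.
    have -> : y = x by exact: W'D.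
    have : (~` DeltaX D `|` D (sval p).1) (sval p).2 by exact: svalP p.
    by rewrite px.
  by exists (exist _ (k, y) ky); split => //; apply: Wg; split; [|left; rewrite px].
have [_ _ Jsub _ _] := J_ideal k.
have [_ _ Jsub' _ _] := J_ideal (k - 1).
apply: (Jsub' (D (k - 1) `\` closure V)).
  move=> x [Dx [p [px gp]]]; split => // clV.
  have : nbhs p (g @^-1` [set r | c < r]).
    apply: open_nbhs_nbhs; split; first by apply: cg; exact: open_gt.
    exact: lt_le_trans gp.
  rewrite nbhs_gluingE => -[W [oW]]; rewrite px /= => Wx Wg.
  have [y [[q [qy gq]] Wy]] := clV W (open_nbhs_nbhs (conj oW Wx)).
  have : c < g q.
    by apply: Wg; split; rewrite qy //= px; right; rewrite subrK.
  by rewrite ltNge (ltW gq).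
apply: J_step => //; apply: Jsub Jk => x [Dx Vx]; split => //.
exists (exist _ (k, x) (or_intror Dx)); split => //.
rewrite leNgt; apply/negP => gx; apply: Vx.
by exists (exist _ (k, x) (or_intror Dx)).
Qed.

(** Passing from one glued set to the next costs an arbitrarily small amount in
    the bound and a set of exceptional points in the ideal. This set is never the
    whole glued set, as the ideal is proper. *)
Lemma bound_propagates (g : Y -> R) (a b : R) n k : continuous g -> a < b ->
  (forall p, DeltaY n p -> g p <= a) -> k <= n ->
  exists2 p, DeltaY k p & g p < b.
Proof.
move=> cg ab ga kn.
have Jc (j : nat) : forall c, a < c -> J (n - j%:Z) (superlevel g (n - j%:Z) c).
  elim: j => [|j IH] c ac.
    rewrite subr0 (_ : superlevel g n c = set0); first by have [] := J_ideal n.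
    apply/seteqP; split => // x [Dx [p [px cp]]].
    have : g p <= a by apply: ga; rewrite /DeltaY /level /= px.
    by move=> /(le_trans cp); rewrite leNgt ac.
  rewrite (_ : n - j.+1%:Z = n - j%:Z - 1); last lia.
  apply: (superlevel_step g _ ((a + c) / 2)) => //; first by lra.
  by apply: IH; lra.
have {Jc} : J k (superlevel g k b).
  by rewrite (_ : k = n - `|n - k|%N%:Z); [exact: Jc|lia].
have [_ _ Jsub _ JD] := J_ideal k.
move=> Jk; apply: contrapT => nop; apply/JD/Jsub/Jk => x Dx; split => //.
exists (exist _ (k, x) (or_intror Dx)); split => //.
rewrite leNgt; apply/negP => gx; apply: nop.
by exists (exist _ (k, x) (or_intror Dx)).
Qed.

Lemma limit_minfty_le (f : Ystar -> R) : continuous f -> f Yminfty <= f Ypinfty.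
Proof.
move=> /[dup] cf /continuousP of_; rewrite leNgt; apply/negP => ff.
pose a := f Ypinfty + (f Yminfty - f Ypinfty) / 3.
pose b := f Ypinfty + (f Yminfty - f Ypinfty) / 3 * 2.
have ab : a < b by rewrite /a /b; lra.
have fa : f Ypinfty < a by rewrite /a; lra.
have fb : b < f Yminfty by rewrite /b; lra.
have [_ /(_ fa)[m ma] _] := of_ _ (@open_lt _ a).
have [_ _ /(_ fb)[m' mb]] := of_ _ (@open_gt _ b).
have cg : continuous (f \o Yin).
  by move=> q; apply: continuous_comp; [exact: Yin_continuous|exact: cf].
have [||p [pk _] gp] :=
    bound_propagates (f \o Yin) a b (m + 1) (Num.min (m + 1) (m' - 1)) cg ab.
- move=> p [pm _]; apply: ltW; apply: (ma (Yin p)).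
  by apply/Vplus_Yin/pinfty_tailE; rewrite pm; lia.
- by rewrite ge_min lexx.
have : b < f (Yin p).
  apply: (mb (Yin p)); apply/Vminus_Yin/minfty_tailE; left.
  by rewrite pk gt_min; apply/orP; right; lia.
by rewrite ltNge (ltW gp).
Qed.

Lemma limits_agree (f : Ystar -> R) : continuous f -> f Ypinfty = f Yminfty.
Proof.
move=> cf; apply/eqP; rewrite eq_le limit_minfty_le// andbT -lerN2.
apply: (limit_minfty_le (fun y => - f y)) => y.
exact: continuousN (cf y).
Qed.

(** A function vanishing at [+oo] and equal to 1 off [Vplus 0] would be small on
    some high glued set, hence somewhere below 1 on the 0-th one. *)
Lemma Yplus_not_completely_regular : ~ completely_regular_T1 (set_type (Yplus D)).
Proof.
move=> [_ cr].
have YS p : Yplus D (Yin p) by left; exists p.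
have [|||||g [cg g1 [W [oW Wp Wg]]]] :=
    completely_regular_pullback R _ _ _ (Vplus 0) Ypinfty Yin cr.
- by right.
- exact: open_Vplus.
- by left.
- exact: Yin_continuous.
- exact: YS.
have [_ /(_ Wp)[m mW] _] := oW.
have [|||p [p0 Dp]] := bound_propagates g 2^-1 1 (Num.max m 0 + 1) 0 cg.
- by rewrite invf_lt1// ltr1n.
- move=> p [pm _]; apply: ltW; apply: Wg; apply: mW.
  by apply/Vplus_Yin/pinfty_tailE; rewrite pm; lia.
- lia.
rewrite g1 ?ltxx// => /Vplus_Yin/pinfty_tailE; rewrite p0 ltxx => -[//|[_]].
by apply; exact: D_sub_DeltaX Dp.
Qed.

(** Bounds travel towards [-oo] only, so the function vanishing at [-oo] and
    equal to 1 off [Vminus 0] is reflected: [1 - g] is null on the 0-th glued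
    set, hence small somewhere on each of the lower ones. *)
Lemma Yminus_not_completely_regular :
  ~ completely_regular_T1 (set_type (Yminus D)).
Proof.
move=> [_ cr].
have YS p : Yminus D (Yin p) by left; exists p.
have [|||||g [cg g1 [W [oW Wp Wg]]]] :=
    completely_regular_pullback R _ _ _ (Vminus 0) Yminfty Yin cr.
- by right.
- exact: open_Vminus.
- by left.
- exact: Yin_continuous.
- exact: YS.
have [_ _ /(_ Wp)[m mW]] := oW.
have cg' : continuous (fun q => 1 - g q).
  by move=> q; apply: continuousB; [exact: cst_continuous|exact: cg].
have [|||p [pk _]] :=
    bound_propagates (fun q => 1 - g q) 0 2^-1 0 (Num.min 0 (m - 1)) cg'.
- by rewrite invr_gt0.
- move=> p [p0 Dp]; rewrite g1 ?subrr// => /Vminus_Yin/minfty_tailE.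
  rewrite p0 ltxx => -[//|[_]]; apply; exact: D_sub_DeltaX Dp.
- lia.
have : g p < 2^-1.
  apply: Wg; apply: mW; apply/Vminus_Yin/minfty_tailE; left.
  by rewrite pk; lia.
by lra.
Qed.

End Gluing.

Theorem mainTheorem3 (R : realType) (X : topologicalType) (D : int -> set X)
    (J : int -> set_system X)
    (X_completely_regular : completely_regular_T1 X)
    (Delta_closed : closed (DeltaX D))
    (Delta_discrete : discrete_subset (DeltaX D))
    (Delta_disjoint : trivIset [set: int] D)
    (J_ideal : forall k : int, proper_set_ideal (D k) (J k))
    (J_step : forall (k : int) (V : set X), open V ->
       J k (D k `\` V) -> J (k - 1) (D (k - 1) `\` closure V)) :
  [/\ completely_regular_T1 (gluing D),
      regular_T1 (gluing_ext D),
      forall f : gluing_ext D -> R, continuous f -> f Ypinfty = f Yminfty,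
      regular_T1 (set_type (Yplus D)) /\
        ~ completely_regular_T1 (set_type (Yplus D))
    & regular_T1 (set_type (Yminus D)) /\
        ~ completely_regular_T1 (set_type (Yminus D))].
Proof.
have rY := gluing_ext_regular R X D X_completely_regular Delta_closed
  Delta_discrete Delta_disjoint.
split.
- exact: (gluing_completely_regular R X D).
- exact: rY.
- exact: (limits_agree R X D _ _ _ J).
- split; first exact: set_type_regular_T1.
  exact: (Yplus_not_completely_regular R X D _ _ _ J).
- split; first exact: set_type_regular_T1.
  exact: (Yminus_not_completely_regular R X D _ _ _ J).
Qed.
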